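(* Let $k\ge1$ be an integer, $a>1$, $0<\alpha<1$, and put $p=1/a$, $\beta=1/k$ and $c=p^{1/\alpha}$ (so $p=c^\alpha$). Let $m$ be the Laplace transform of a probability distribution on $(0,\infty)$, and let $F(j)=1-m(j)$, $j\in\{0,1,2,\ldots\}$, be the associated distribution function on $\{0,1,2,\ldots\}$. Let $N$ have the Harris($a,k$) law. Then $F$ is $N$-min stable with constant $c$ if and only if $F$ is discrete generalized semi-Pareto($p,\alpha,\beta$).
   Context: If $m(s)=\int_{(0,\infty)}e^{-st}\,\mu(dt)$, $s\ge0$, is the Laplace transform of a probability measure $\mu$ on $(0,\infty)$, then $P\{X<j\}=F(j)=1-m(j)$, $j\in\{0,1,2,\ldots\}$, defines the distribution function $F$ of a random variable $X$ on $\{0,1,2,\ldots\}$ (distribution functions are here taken in the form $P\{X<j\}$); all distribution functions on $\{0,1,2,\ldots\}$ considered are of this form. For $c>0$, $s\mapsto m(cs)$ is again a Laplace transform, and one sets $F(cj)=1-m(cj)$ and $R(cj)=1-F(cj)=m(cj)$ for $j\in\{0,1,2,\ldots\}$. For a $\{1,2,\ldots\}$-valued random variable $N$ with probability generating function $Q(s)=E[s^N]$, $F$ is called $N$-min stable with constant $c\in(0,1)$ if $Q[R(cj)]=R(j)$, i.e. $Q[m(cj)]=m(j)$, for all $j\in\{0,1,2,\ldots\}$. The Harris($a,k$) law, with $a>1$ real and $k\ge1$ an integer, is the law on $\{1,2,\ldots\}$ with probability generating function $s/[a-(a-1)s^k]^{1/k}$. A distribution function $F$ on $\{0,1,2,\ldots\}$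 is discrete generalized semi-Pareto($p,\alpha,\beta$), with $0<p<1$, $0<\alpha<1$, $\beta>0$, if $F(j)=1-[1+\psi(j)]^{-\beta}$ for all $j\in\{0,1,2,\ldots\}$, where $\psi:[0,\infty)\to[0,\infty)$ satisfies $\psi(0)=0$ and $\psi(x)=\psi(p^{1/\alpha}x)/p$ for all $x>0$, and $x\mapsto[1+\psi(x)]^{-\beta}$ is the Laplace transform of a probability distribution on $(0,\infty)$. *)

(* Defs.v *)
From HB Require Import structures.
From mathcomp Require Import all_boot all_order all_algebra.
From mathcomp Require Import all_classical all_reals all_analysis.

Set Implicit Arguments.
Unset Strict Implicit.
Unset Printing Implicit Defensive.

Import Order.TTheory GRing.Theory Num.Theory.
Import numFieldNormedType.Exports.

Local Open Scope classical_set_scope.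
Local Open Scope ring_scope.

Definition laplace (R : realType) (mu : probability (measurableTypeR R) R)
    (s : R) : R :=
  \int[mu]_(t in `]0, +oo[) expR (- (s * t)).

(* A probability distribution on (0, +oo) is encoded as a Borel probability on
   R giving mass 1 to (0, +oo).  Only the values of m on [0, +oo) matter. *)
Definition is_laplace_transform (R : realType) (m : R -> R) : Prop :=
  exists mu : probability (measurableTypeR R) R,
    mu `]0, +oo[%classic = 1%E /\ forall s : R, 0 <= s -> m s = laplace mu s.

(* The distribution function associated with m, in the convention
   F j = P {X < j}; it is kept as a function of a real argument because
   N-min stability evaluates it at the points c * j. *)
Definition laplace_df (R : realType) (m : R -> R) : R -> R :=
  fun x => 1 - m x.

Definition survival (R : realType) (F : R -> R) : R -> R := fun x => 1 - F x.

(* The expectation is finite for 0 <= s <= 1, the only range used below. *)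
Definition pgf (R : realType) (d : measure_display) (T : measurableType d)
    (P : probability T R) (N : {RV P >-> nat}) (s : R) : R :=
  fine 'E_P[fun w => s ^+ N w].

(* The equation on [0, 1] determines the law of N. *)
Definition has_harris_law (R : realType) (d : measure_display)
    (T : measurableType d) (P : probability T R) (N : {RV P >-> nat})
    (a : R) (k : nat) : Prop :=
  distribution P N [set n | (1 <= n)%N] = 1%E /\
  forall s : R, 0 <= s <= 1 ->
    pgf N s = s / (a - (a - 1) * s ^+ k) `^ (k%:R^-1).

Definition min_stable (R : realType) (d : measure_display)
    (T : measurableType d) (P : probability T R) (N : {RV P >-> nat})
    (c : R) (F : R -> R) : Prop :=
  0 < c < 1 /\
  forall j : nat, pgf N (survival F (c * j%:R)) = survival F j%:R.

(* psi : [0, +oo) -> [0, +oo) is encoded as a function on R of which only the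
   values on [0, +oo) are constrained or used. *)
Definition discrete_gen_semi_pareto (R : realType) (p alpha beta : R)
    (F : R -> R) : Prop :=
  [/\ 0 < p < 1, 0 < alpha < 1, 0 < beta &
    exists psi : R -> R,
      [/\ forall x : R, 0 <= x -> 0 <= psi x,
          psi 0 = 0,
          forall x : R, 0 < x -> psi x = psi (p `^ (alpha^-1) * x) / p,
          is_laplace_transform (fun x => (1 + psi x) `^ (- beta)) &
          forall j : nat, F j%:R = 1 - (1 + psi j%:R) `^ (- beta)]].

(* Main.v *)
Require Import Defs.
From HB Require Import structures.
From mathcomp Require Import all_boot all_order all_algebra.
From mathcomp Require Import all_classical all_reals all_analysis.
From mathcomp Require Import measurable_realfun.
From mathcomp Require Import ring lra.

Import Order.TTheory GRing.Theory Num.Theory.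
Import numFieldNormedType.Exports.

Local Open Scope classical_set_scope.
Local Open Scope ring_scope.

(** The Harris generating function [Q] satisfies
    [Q x ^- k - 1 = a * (x ^- k - 1)], so for [psi := m ^- k - 1] min stability
    says [psi j = a * psi (c * j)] at integers [j]; the two notions agree once
    identities between Laplace transforms known on the integers extend to all
    of [0, +oo).  To avoid constructing the measure whose transform is
    [s |-> Q (m (c * s))], Laplace transforms are replaced by functions [h] such
    that [\sum_i a_i h(s_i) >= 0] whenever [\sum_i a_i expR (- (s_i * t)) >= 0]
    for all [t >= 0].  This class is closed under products, dilations and
    mixtures, and a uniform approximation of [expR (- (r * t))] by exponential
    sums with integer exponents forces two normalized members agreeing on the
    integers to agree at [r]. *)

(** * Functionals positive on exponential sums *)

Definition exp_sum {R : realType} (l : seq (R * R)) (t : R) : R :=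
  \sum_(x <- l) x.1 * expR (- (x.2 * t)).

(** Equivalently, sending [expR (- (s * t))] to [h s], for [s >= 0], defines a positive linear
    functional on exponential sums over [t >= 0]. *)
Definition exp_positive {R : realType} (h : R -> R) : Prop :=
  forall l : seq (R * R), (forall x, x \in l -> 0 <= x.2) ->
    (forall t, 0 <= t -> 0 <= exp_sum l t) -> 0 <= \sum_(x <- l) x.1 * h x.2.

(* For fixed [t], the positive functional attached to [h] is applied to
   [u |-> exp_sum l (t + u)]; the one attached to [g] is applied to the result. *)
Lemma exp_positiveM (R : realType) (g h : R -> R) :
  exp_positive g -> exp_positive h -> exp_positive (fun s => g s * h s).
Proof.
move=> gP hP l l0 lP.
have -> : \sum_(x <- l) x.1 * (g x.2 * h x.2) =
    \sum_(y <- [seq (x.1 * h x.2, x.2) | x <- l]) y.1 * g y.2.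
  by rewrite big_map; apply: eq_bigr => x _; rewrite /= [g _ * _]mulrC mulrA.
apply: gP => [_ /mapP[y yl ->]|t t0]; first exact: (l0 y).
have -> : exp_sum [seq (x.1 * h x.2, x.2) | x <- l] t =
    \sum_(y <- [seq (x.1 * expR (- (x.2 * t)), x.2) | x <- l]) y.1 * h y.2.
  by rewrite /exp_sum !big_map; apply: eq_bigr => x _; rewrite /= mulrAC.
apply: hP => [_ /mapP[y yl ->]|u u0]; first exact: (l0 y).
have := lP (t + u) (addr_ge0 t0 u0); rewrite /exp_sum big_map /=.
by under eq_bigr do rewrite mulrDr opprD expRD mulrA.
Qed.

Lemma exp_positive_exp (R : realType) (t : R) : 0 <= t ->
  exp_positive (fun s => expR (- (s * t))).
Proof. by move=> t0 l _ /(_ t t0). Qed.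

Lemma exp_positiveX (R : realType) (h : R -> R) (n : nat) :
  exp_positive h -> exp_positive (fun s => h s ^+ n).
Proof.
(* For [n = 0], the sum of the coefficients is [exp_sum l] at [t = 0]. *)
move=> hP; elim: n => [l _ /(_ 0 (lexx 0))|n IHn].
  by rewrite /exp_sum; under eq_bigr do rewrite mulr0 oppr0 expR0.
move=> l l0 lP; under eq_bigr do rewrite exprS; exact: (exp_positiveM R h (fun s => h s ^+ n)).
Qed.

Lemma exp_positive_dilation (R : realType) (c : R) (h : R -> R) : 0 <= c ->
  exp_positive h -> exp_positive (fun s => h (c * s)).
Proof.
move=> c0 hP l l0 lP.
have := hP [seq (x.1, c * x.2) | x <- l].
rewrite big_map /=; apply.
- by move=> x /mapP[y yl ->] /=; rewrite mulr_ge0// l0.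
- move=> t t0; have := lP (c * t) (mulr_ge0 c0 t0).
  by rewrite /exp_sum big_map /=; under eq_bigr do rewrite mulrCA mulrA.
Qed.

(** The bounds make each [h ^~ s] integrable, so the finite sum passes under the integral, where it
    is nonnegative for every [w] in [D]. *)
Lemma exp_positive_Rintegral (R : realType) (d : measure_display)
    (T : measurableType d) (P : probability T R) (D : set T) (h : T -> R -> R) :
  measurable D ->
  (forall s, 0 <= s -> measurable_fun D (h ^~ s)) ->
  (forall w s, D w -> 0 <= s -> 0 <= h w s <= 1) ->
  (forall w, D w -> exp_positive (h w)) ->
  exp_positive (fun s => \int[P]_(w in D) h w s).
Proof.
move=> mD mh h01 hP l l0 lP.
have hint s : 0 <= s -> P.-integrable D (EFin \o h ^~ s).
  move=> s0; apply: measurable_bounded_integrable => //.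
  - by rewrite (le_lt_trans (probability_le1 P mD))// ltry.
  - exact: mh.
  - exists 1; split => // M M1 w Dw /=.
    by have /andP[h0 h1] := h01 w s Dw s0; rewrite ger0_norm// (le_trans h1)// ltW.
suff -> : \sum_(x <- l) x.1 * (\int[P]_(w in D) h w x.2) =
    \int[P]_(w in D) \sum_(x <- l) x.1 * h w x.2.
  by apply: Rintegral_ge0 => w Dw; exact: hP.
(* Integrability joins the induction because additivity of the integral needs it for the tail. *)
suff [] : P.-integrable D (EFin \o (fun w => \sum_(x <- l) x.1 * h w x.2)) /\
  \sum_(x <- l) x.1 * (\int[P]_(w in D) h w x.2) =
    \int[P]_(w in D) \sum_(x <- l) x.1 * h w x.2 by [].
elim: l l0 {lP} => [|x l IHl] l0.
  have -> : (fun w => \sum_(x <- [::]) x.1 * h w x.2) = fun=> 0.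
    by apply/funext => w; rewrite big_nil.
  by rewrite big_nil Rintegral_cst// mul0r; split => //; exact: integrable0.
have [|il el] := IHl; first by move=> y yl; rewrite l0// inE yl orbT.
have x0 : 0 <= x.2 by rewrite l0// mem_head.
have ix : P.-integrable D (EFin \o (fun w => x.1 * h w x.2)).
  by have := integrableZl mD x.1 (hint _ x0); apply: eq_integrable.
rewrite big_cons el -RintegralZl//; last exact: hint.
rewrite -RintegralD//; split; last first.
  by apply: eq_Rintegral => w _; rewrite big_cons.
under eq_fun do rewrite big_cons.
exact: (integrableD mD ix il).
Qed.

(** * Laplace transforms of probability measures on the half-line *)

Lemma measurable_expRN (R : realType) (D : set (measurableTypeR R)) (s : R) :
  measurable_fun D (fun t : R => expR (- (s * t))).
Proof.
apply: measurable_funTS; apply: measurableT_comp => //.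
under eq_fun do rewrite -mulNr.
exact: measurable_funM.
Qed.

Lemma exp_positive_laplace (R : realType) (m : R -> R) :
  is_laplace_transform m -> exp_positive m.
Proof.
move=> [mu [_ mE]] l l0 lP; rewrite big_seq.
under eq_bigr => x xl do rewrite mE ?l0//.
rewrite -big_seq.
apply: (exp_positive_Rintegral R _ _ mu `]0, +oo[%classic
  (fun t s => expR (- (s * t)))) l l0 lP => //.
- by move=> s s0; exact: measurable_expRN.
- move=> t s /=; rewrite in_itv /= andbT => t0 s0.
  by rewrite expR_ge0 /= -expR0 ler_expR oppr_le0 mulr_ge0// ltW.
- move=> t /=; rewrite in_itv /= andbT => /ltW; exact: exp_positive_exp.
Qed.

Lemma laplace_at0 (R : realType) (m : R -> R) : is_laplace_transform m -> m 0 = 1.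
Proof.
move=> [mu [mu1 mE]]; rewrite mE// /laplace.
under eq_Rintegral do rewrite mul0r oppr0 expR0.
rewrite Rintegral_cst// mul1r; transitivity (fine (1 : \bar R)) => //.
congr fine; exact: mu1.
Qed.

Lemma laplace_le1 (R : realType) (m : R -> R) (s : R) :
  is_laplace_transform m -> 0 <= s -> m s <= 1.
Proof.
move=> hm s0; rewrite -(laplace_at0 R m hm) -subr_ge0.
(* The list encodes [1 - expR (- (s * t))]. *)
have := exp_positive_laplace R m hm [:: (1, 0); (-1, s)].
rewrite /exp_sum big_cons big_seq1 /= mul1r mulN1r; apply.
  by move=> x; rewrite !inE => /orP[]/eqP ->.
move=> t t0; rewrite big_cons big_seq1 /= mul0r oppr0 expR0 mul1r mulN1r.
by rewrite subr_ge0 -expR0 ler_expR oppr_le0 mulr_ge0.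
Qed.

(** The integrand never vanishes, so a zero integral would make the domain, of mass 1, a null
    set. *)
Lemma laplace_gt0 (R : realType) (m : R -> R) (s : R) :
  is_laplace_transform m -> 0 <= s -> 0 < m s.
Proof.
move=> hm s0; have [mu [mu1 mE]] := hm; rewrite mE//.
have e0 t : 0 <= expR (- (s * t)) by exact: expR_ge0.
pose D : set (measurableTypeR R) := `]0, +oo[%classic.
have mD : measurable D := measurable_itv _.
have muD : mu D = 1%E := mu1.
have me : measurable_fun D (fun t : R => expR (- (s * t))).
  exact: measurable_expRN.
have ie : mu.-integrable D (EFin \o (fun t : R => expR (- (s * t)))).
  apply: measurable_bounded_integrable => //.
    by rewrite (le_lt_trans (probability_le1 mu mD))// ltry.
  exists 1; split => // M M1 t; rewrite /D /= in_itv /= andbT => t0.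
  rewrite ger0_norm// (le_trans _ (ltW M1))// -expR0 ler_expR oppr_le0.
  by rewrite mulr_ge0// ltW.
rewrite lt_neqAle Rintegral_ge0// andbT eq_sym; apply/eqP => I0.
have : (\int[mu]_(t in D) `|(expR (- (s * t)))%:E| = 0)%E.
  under eq_integral do rewrite gee0_abs ?lee_fin//.
  rewrite -[LHS]fineK; first by rewrite -/(Rintegral _ _ _) -/(laplace mu s) I0.
  exact: integrable_fin_num.
move=> /(ae_eq_integral_abs mu (measurable_itv _)) [].
  exact/measurable_EFinP.
move=> A [mA A0 sA].
have : (mu D <= mu A)%E.
  apply: le_measure; rewrite ?inE//.
  move=> t t0; apply: sA => /(_ t0) /eqP; rewrite /= eqe.
  by rewrite gt_eqF// expR_gt0.
by rewrite muD A0 lee_fin ler10.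
Qed.

(** * Uniqueness from values on the integers *)

(** Positivity is applied to [e] plus and minus the approximation error; the constant [e] is a term
    of exponent 0, worth [e * h 0 = e]. *)
Lemma exp_positive_approx (R : realType) (h : R -> R) (l : seq (R * R)) (e r : R) :
  exp_positive h -> h 0 = 1 -> 0 <= r -> (forall x, x \in l -> 0 <= x.2) ->
  (forall t, 0 <= t -> `|expR (- (r * t)) - exp_sum l t| <= e) ->
  `|h r - \sum_(x <- l) x.1 * h x.2| <= e.
Proof.
move=> hP h0 r0 l0 lr; rewrite ler_norml; apply/andP; split.
- have := hP ((e, 0) :: (1, r) :: [seq (- x.1, x.2) | x <- l]).
  rewrite !big_cons big_map /= h0 mulr1 mul1r.
  under eq_bigr do rewrite mulNr; rewrite sumrN => H.
  suff : 0 <= e + (h r - \sum_(x <- l) x.1 * h x.2) by lra.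
  apply: H => [x|t t0].
    rewrite !inE => /or3P[/eqP->|/eqP->|/mapP[y yl ->]]//=; exact: l0 y yl.
  rewrite /exp_sum !big_cons big_map /= mul0r oppr0 expR0 mulr1 mul1r.
  under eq_bigr do rewrite mulNr; rewrite sumrN -/(exp_sum l t).
  by have := lr t t0; rewrite ler_norml => /andP[]; lra.
- have := hP ((e, 0) :: (-1, r) :: l).
  rewrite !big_cons /= h0 mulr1 mulN1r => H.
  suff : 0 <= e + (- h r + \sum_(x <- l) x.1 * h x.2) by lra.
  apply: H => [x|t t0].
    by rewrite !inE => /or3P[/eqP->|/eqP->|/l0].
  rewrite /exp_sum !big_cons /= mul0r oppr0 expR0 mulr1 mulN1r -/(exp_sum l t).
  by have := lr t t0; rewrite ler_norml => /andP[]; lra.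
Qed.

(** [g] and [h] give the approximating sum the same value, and [g r] and [h r] both lie within
    [e / 2] of it. *)
Lemma exp_positive_eq (R : realType) (g h : R -> R) (r : R) :
  exp_positive g -> exp_positive h -> g 0 = 1 -> h 0 = 1 -> 0 <= r ->
  (forall e, 0 < e -> exists2 l : seq (R * R),
    (forall x, x \in l -> 0 <= x.2 /\ g x.2 = h x.2) &
    forall t, 0 <= t -> `|expR (- (r * t)) - exp_sum l t| <= e) ->
  g r = h r.
Proof.
move=> gP hP g0 h0 r0 ex; apply/eqP; rewrite -subr_eq0 -normr_le0.
apply/ler_addgt0Pl => e e0; rewrite addr0.
have [l lgh lr] := ex (e / 2) ltac:(by rewrite divr_gt0).
have l0 x : x \in l -> 0 <= x.2 by case/lgh.
have := exp_positive_approx R g l (e / 2) r gP g0 r0 l0 lr.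
have := exp_positive_approx R h l (e / 2) r hP h0 r0 l0 lr.
have -> : \sum_(x <- l) x.1 * g x.2 = \sum_(x <- l) x.1 * h x.2.
  by rewrite big_seq [RHS]big_seq; apply: eq_bigr => x /lgh[_ ->].
rewrite !ler_norml => /andP[? ?] /andP[? ?]; lra.
Qed.

(* Newton-like iteration [q + (x - q ^ 2) / 2], which increases to [sqrt x]
   uniformly on [0, 1]. *)
Fixpoint sqrt_poly {R : realType} (n : nat) : {poly R} :=
  if n is n'.+1 then sqrt_poly n' + 2^-1 *: ('X - sqrt_poly n' ^+ 2) else 0.

Lemma sqrt_poly_bound (R : realType) (n : nat) (v : R) : 0 <= v <= 1 ->
  0 <= v - (sqrt_poly n).[v ^+ 2] /\ (v - (sqrt_poly n).[v ^+ 2]) * n%:R <= 2.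
Proof.
move=> /andP[v0 v1].
(* Each iteration multiplies the error by [1 - (v + q) / 2], at most [1 - v / 2]; this rate
   propagates the third bound. *)
have [q0 qv qn] : [/\ 0 <= (sqrt_poly n).[v ^+ 2], (sqrt_poly n).[v ^+ 2] <= v &
    (v - (sqrt_poly n).[v ^+ 2]) * (2 + n%:R * v) <= 2 * v].
  elim: n => [|n [q0 qv qn]]; first by rewrite /= horner0; split => //; lra.
  rewrite /= hornerD hornerZ hornerD hornerN hornerX horner_exp.
  move: (sqrt_poly n).[v ^+ 2] q0 qv qn => q q0 qv qn.
  have e1 : v - (q + 2^-1 * (v ^+ 2 - q ^+ 2)) = (v - q) * (1 - (v + q) / 2).
    by field.
  split.
  - by rewrite addr_ge0// mulr_ge0 ?invr_ge0// subr_ge0 lerXn2r.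
  - by rewrite -subr_ge0 e1 mulr_ge0//; lra.
  - have n0 : 0 <= n%:R :> R by [].
    rewrite e1 -[n.+1%:R]natr1; apply: le_trans qn; rewrite -mulrA ler_wpM2l ?subr_ge0//.
    move: (n%:R : R) n0 => N N0.
    have : 0 <= v * q by rewrite mulr_ge0.
    have : 0 <= N * (v * q) by rewrite !mulr_ge0.
    have : 0 <= N * (v * v) by rewrite !mulr_ge0.
    have : 0 <= v * v by rewrite mulr_ge0.
    nra.
move: (sqrt_poly n).[v ^+ 2] q0 qv qn => q q0 qv qn; split; first by rewrite subr_ge0.
(* The bound [2 / n] comes from cancelling [v] in the invariant, so [v = 0] is treated apart. *)
move: v0; rewrite le_eqVlt => /predU1P[v0|v0].
  move: qv q0; rewrite -v0 => ? ?.
  have -> : q = 0 by lra.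
  by rewrite subr0 mul0r.
rewrite -(ler_pM2r v0); apply: le_trans qn.
by rewrite -mulrA ler_wpM2l ?subr_ge0// lerDr.
Qed.

Lemma horner_exp_sum (R : realType) (p : {poly R}) (s t : R) :
  p.[expR (- (s * t))] =
  exp_sum [seq (p`_i, i%:R * s) | i <- index_iota 0 (size p)] t.
Proof.
rewrite horner_coef /exp_sum big_map big_mkord; apply: eq_bigr => i _ /=.
by rewrite -[expR (- (s * t)) ^+ i]expRM_natl mulrN mulrA.
Qed.

(** Even multiples of [s / 2] are multiples of [s]. For odd ones, with [v = expR (- (s / 2 * t))],
    the target is [(v ^+ 2) ^+ i * v], and [v] is approximated by a polynomial in
    [v ^+ 2 = expR (- (s * t))]. *)
Lemma exp_positive_eq_half (R : realType) (g h : R -> R) (s : R) :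
  exp_positive g -> exp_positive h -> g 0 = 1 -> h 0 = 1 -> 0 <= s ->
  (forall j : nat, g (j%:R * s) = h (j%:R * s)) ->
  forall j : nat, g (j%:R * (s / 2)) = h (j%:R * (s / 2)).
Proof.
move=> gP hP g0 h0 s0 gh j.
have s20 : 0 <= s / 2 by rewrite divr_ge0.
rewrite -[j]odd_double_half; case: (odd j) => /=; last first.
  have -> : (0 + j./2.*2)%:R * (s / 2) = j./2%:R * s.
    by rewrite add0n -muln2 natrM; field.
  exact: gh.
set i := j./2; apply: exp_positive_eq => //; first by rewrite mulr_ge0.
move=> e e0.
pose n := (Num.truncn (2 / e)).+1.
have ne : 2 <= n%:R * e by rewrite -ler_pdivrMr// ltW// truncnS_gt.
pose p : {poly R} := 'X^i * sqrt_poly n.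
exists [seq (p`_i, i%:R * s) | i <- index_iota 0 (size p)].
  by move=> _ /mapP[y _ ->] /=; rewrite mulr_ge0.
move=> t t0; rewrite -horner_exp_sum.
pose v := expR (- (s / 2 * t)).
have v01 : 0 <= v <= 1.
  by rewrite expR_ge0 /= -expR0 ler_expR oppr_le0 mulr_ge0.
have -> : expR (- (s * t)) = v ^+ 2.
  by rewrite /v -expRM_natl; congr expR; field.
have -> : expR (- ((1 + i.*2)%:R * (s / 2) * t)) = (v ^+ 2) ^+ i * v.
  rewrite /v -exprM -!expRM_natl -expRD; congr expR.
  by rewrite natrD -mul2n natrM; ring.
rewrite /p hornerM hornerXn -mulrBr.
have [b0 bn] := sqrt_poly_bound R n v v01.
rewrite ger0_norm; last by rewrite mulr_ge0// exprn_ge0// exprn_ge0//; lra.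
rewrite (@le_trans _ _ (v - (sqrt_poly n).[v ^+ 2]))//.
  by rewrite ler_piMl// exprn_ile1 ?exprn_ge0 ?exprn_ile1//; case/andP: v01.
have n0 : 0 < n%:R :> R by rewrite ltr0n.
by rewrite -(ler_pM2r n0) (le_trans bn)// mulrC.
Qed.

(* Halving the step reaches all dyadic exponents; a real exponent [s > 0] is
   then approached by dyadics [r >= s], since
   [0 <= expR (- (s * t)) - expR (- (r * t)) <= (r - s) / s] uniformly in [t]. *)
Lemma exp_positive_uniq (R : realType) (g h : R -> R) :
  exp_positive g -> exp_positive h -> g 0 = 1 -> h 0 = 1 ->
  (forall j : nat, g j%:R = h j%:R) -> forall s, 0 <= s -> g s = h s.
Proof.
move=> gP hP g0 h0 gh s.
have dyadic n : forall j : nat, g (j%:R * 2^-1 ^+ n) = h (j%:R * 2^-1 ^+ n).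
  elim: n => [j|n IHn j]; first by rewrite mulr1.
  rewrite exprSr; exact: exp_positive_eq_half.
rewrite le_eqVlt => /predU1P[<-|s0]; first exact: (gh 0%N).
apply: exp_positive_eq => //; first exact: ltW.
move=> e e0.
(* Since [n < 2 ^ n], the dyadic step is at most [s * e], whence [(r - s) / s <= e]. *)
pose n := (Num.truncn ((s * e)^-1)).+1.
have n2 : 2^-1 ^+ n <= s * e.
  rewrite exprVn -[leRHS]invrK lef_pV2 ?posrE ?exprn_gt0 ?invr_gt0 ?mulr_gt0//.
  rewrite (le_trans (ltW (truncnS_gt _)))// -/n -natrX ler_nat.
  exact/ltnW/ltn_expl.
set u := 2^-1 ^+ n in n2.
have u0 : 0 < u by rewrite exprn_gt0// invr_gt0.
pose r := (Num.truncn (s / u)).+1%:R * u.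
have sr : s <= r by rewrite -ler_pdivrMr// ltW// truncnS_gt.
have rs : r - s <= u.
  rewrite /r -natr1 mulrDl mul1r addrAC gerDr subr_le0 -ler_pdivlMr//.
  by rewrite truncn_le// divr_ge0 ?ltW.
exists [:: (1, r)].
  move=> x; rewrite inE => /eqP -> /=; split; first by rewrite (le_trans _ sr)// ltW.
  exact: dyadic.
move=> t t0; rewrite /exp_sum big_seq1 /= mul1r.
rewrite ger0_norm; last first.
  by rewrite subr_ge0 ler_expR lerN2 ler_wpM2r.
have E0 := expR_gt0 (- (s * t)).
have -> : expR (- (r * t)) = expR (- (s * t)) * expR (- ((r - s) * t)).
  by rewrite -expRD; congr expR; ring.
have d1 : 1 - expR (- ((r - s) * t)) <= s * e * t.
  have := expR_ge1Dx (- ((r - s) * t)).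
  have : (r - s) * t <= s * e * t by rewrite ler_wpM2r// (le_trans rs).
  lra.
(* The decay absorbs the unbounded factor [t]. *)
have d2 : expR (- (s * t)) * (s * t) <= 1.
  have := expR_ge1Dx (s * t); rewrite expRN [_^-1 * _]mulrC ler_pdivrMr ?expR_gt0//; lra.
have d3 : expR (- (s * t)) * (s * e * t) <= e.
  have -> : expR (- (s * t)) * (s * e * t) = e * (expR (- (s * t)) * (s * t)) by ring.
  by rewrite ger_pMr.
rewrite -{1}[expR (- (s * t))]mulr1 -mulrBr.
exact: (le_trans (ler_wpM2l (ltW E0) d1) d3).
Qed.

(** * Generating functions and the Harris law *)

(** The expectation is a mixture over outcomes [w] of the powers [h s ^+ N w]. *)
Lemma exp_positive_pgf (R : realType) (d : measure_display)
    (T : measurableType d) (P : probability T R) (N : {RV P >-> nat})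
    (h : R -> R) :
  exp_positive h -> (forall s, 0 <= s -> 0 <= h s <= 1) ->
  exp_positive (fun s => pgf N (h s)).
Proof.
move=> hP h01.
have -> : (fun s => pgf N (h s)) = fun s => \int[P]_(w in setT) h s ^+ N w.
  by apply/funext => s; rewrite /pgf unlock.
apply: (exp_positive_Rintegral R _ _ P setT (fun w s => h s ^+ N w)) => //.
- move=> s s0; apply: (@measurableT_comp _ _ _ _ _ _ (fun n => h s ^+ n)) => //.
- move=> w s _ s0; have /andP[h0 h1] := h01 s s0.
  by rewrite exprn_ge0// exprn_ile1.
- by move=> w _; exact: exp_positiveX.
Qed.

Lemma powR_expVn (R : realType) (k : nat) (x : R) : (0 < k)%N -> 0 < x ->
  (x ^- k) `^ (- (1 / k%:R)) = x.
Proof.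
move=> k0 x0; rewrite -powR_invn ?ltW// -powRrM mulrNN mulrC divfK.
  by rewrite powRr1// ltW.
by rewrite pnatr_eq0 -lt0n.
Qed.

Lemma expVn_powR (R : realType) (k : nat) (y : R) : (0 < k)%N -> 0 < y ->
  (y `^ (- (1 / k%:R))) ^- k = y.
Proof.
move=> k0 y0; rewrite -powR_invn ?powR_ge0// -powRrM mulrNN divfK.
  by rewrite powRr1// ltW.
by rewrite pnatr_eq0 -lt0n.
Qed.

Lemma expVn_inj (R : realType) (k : nat) (x y : R) : (0 < k)%N ->
  0 < x -> 0 < y -> x ^- k = y ^- k -> x = y.
Proof. by move=> k0 x0 y0 e; rewrite -(powR_expVn _ k x)// e powR_expVn. Qed.

(* The generating function of the Harris law is conjugate to multiplication by
   [a] through [x |-> x ^- k - 1]. *)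
Lemma harris_pgfE (R : realType) (d : measure_display) (T : measurableType d)
    (P : probability T R) (N : {RV P >-> nat}) (a : R) (k : nat) (x : R) :
  (0 < k)%N -> 1 < a -> has_harris_law N a k -> 0 < x <= 1 ->
  0 < pgf N x /\ (pgf N x) ^- k - 1 = a * (x ^- k - 1).
Proof.
move=> k0 a1 [_ hN] /andP[x0 x1]; rewrite hN; last by rewrite x1 ltW.
set D := a - (a - 1) * x ^+ k.
have xk0 : 0 < x ^+ k by rewrite exprn_gt0.
have xk1 : x ^+ k <= 1 by rewrite exprn_ile1// ltW.
have D0 : 0 < D.
  have : (a - 1) * x ^+ k <= (a - 1) * 1 by rewrite ler_wpM2l// subr_ge0 ltW.
  by rewrite /D; lra.
split; first by rewrite divr_gt0// powR_gt0.
have Dk : (D `^ k%:R^-1) ^+ k = D.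
  rewrite -powR_mulrn ?powR_ge0// -powRrM mulVf ?powRr1 ?ltW//.
  by rewrite pnatr_eq0 -lt0n.
rewrite exprMn exprVn Dk invfM invrK /D; field.
by rewrite gt_eqF.
Qed.

Lemma harris_pgf1 (R : realType) (d : measure_display) (T : measurableType d)
    (P : probability T R) (N : {RV P >-> nat}) (a : R) (k : nat) :
  has_harris_law N a k -> pgf N 1 = 1.
Proof.
move=> [_ ->]; last by rewrite ler01 lexx.
by rewrite expr1n mulr1 opprB addrC subrK powR1 divr1.
Qed.

(** * Min stability and the semi-Pareto form *)

Theorem mainTheorem7 (R : realType) (k : nat) (a alpha p beta c : R)
  (hk : (1 <= k)%N) (ha : 1 < a) (halpha : 0 < alpha < 1)
  (hp : p = 1 / a) (hbeta : beta = 1 / k%:R) (hc : c = p `^ (1 / alpha))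
  (m : R -> R) (hm : is_laplace_transform m)
  (d : measure_display) (T : measurableType d) (P : probability T R)
  (N : {RV P >-> nat}) (hN : has_harris_law N a k) :
  min_stable N c (laplace_df m) <->
  discrete_gen_semi_pareto p alpha beta (laplace_df m).
Proof.
have a0 : 0 < a by rewrite (lt_trans ltr01).
have p0 : 0 < p by rewrite hp divr_gt0.
have p1 : p < 1 by rewrite hp ltr_pdivrMr// mul1r.
have /andP[al0 al1] := halpha.
have c0 : 0 < c by rewrite hc powR_gt0.
have c1 : c < 1.
  have := gt0_ltr_powR (divr_gt0 ltr01 al0) (ltW p0) ler01 p1.
  by rewrite -hc powR1.
have cE : p `^ alpha^-1 = c by rewrite hc div1r.
have divp x : x / p = a * x by rewrite hp div1r invrK mulrC.
have b0 : 0 < beta by rewrite hbeta divr_gt0// ltr0n.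
have m01 s : 0 <= s -> 0 < m s <= 1.
  by move=> s0; rewrite (laplace_gt0 R m s hm s0) (laplace_le1 R m s hm s0).
have m0 := laplace_at0 R m hm.
have survE x : survival (laplace_df m) x = m x.
  by rewrite /survival /laplace_df opprB addrC subrK.
have cx0 x : 0 <= x -> 0 <= c * x by move=> x0; rewrite mulr_ge0// ltW.
split=> [[_ stable]|[_ _ _ [psi [psi_ge0 psi0 psi_scale psi_lt psi_df]]]].
(* The scaling law of [psi] concerns all real arguments, so stability is first extended from the
   integers by uniqueness. *)
- have stableR s : 0 <= s -> pgf N (m (c * s)) = m s.
    apply: (exp_positive_uniq R (fun s => pgf N (m (c * s))) m) => //.
    + apply: (exp_positive_pgf R _ _ P N (fun s => m (c * s))).
        apply: exp_positive_dilation; first exact: ltW.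
        exact: exp_positive_laplace.
      by move=> u u0; have /andP[/ltW -> ->] := m01 _ (cx0 _ u0).
    + exact: exp_positive_laplace.
    + by rewrite mulr0 m0; exact: harris_pgf1 hN.
    + by move=> j; rewrite -[RHS]survE -stable survE.
  split; [by rewrite p0 p1|by []|by []|].
  have rootE s : 0 <= s -> (1 + (m s ^- k - 1)) `^ (- beta) = m s.
    move=> s0; rewrite addrC subrK hbeta powR_expVn//.
    by have /andP[] := m01 s s0.
  (* This solves [m = (1 + psi) ^ (- 1 / k)] for [psi]. *)
  exists (fun s => m s ^- k - 1); split.
  + move=> s s0; have /andP[ms0 ms1] := m01 s s0.
    by rewrite subr_ge0 invf_ge1 ?exprn_gt0// exprn_ile1// ltW.
  + by rewrite m0 expr1n invr1 subrr.
  + move=> s /ltW s0; rewrite cE divp -{1}(stableR s s0).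
    by have [] := harris_pgfE R _ _ P N a k _ hk ha hN (m01 _ (cx0 _ s0)).
  + have [mu [mu1 mE]] := hm.
    by exists mu; split => // s s0; rewrite rootE// mE.
  + by move=> j; rewrite rootE.
- split; first by rewrite c0 c1.
  (* [psi_df] speaks of integers only, while stability involves the points [c * j]; uniqueness
     bridges the gap. *)
  have mE s : 0 <= s -> (1 + psi s) `^ (- beta) = m s.
    apply: (exp_positive_uniq R (fun s => (1 + psi s) `^ (- beta)) m).
    + exact: exp_positive_laplace.
    + exact: exp_positive_laplace.
    + by rewrite psi0 addr0 powR1.
    + by [].
    + by move=> j; have := psi_df j; rewrite /laplace_df => /addrI/oppr_inj.
  have psiE s : 0 <= s -> psi s = m s ^- k - 1.
    move=> s0; rewrite -mE// hbeta expVn_powR//; first by rewrite addrC addKr.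
    by rewrite ltr_pwDl// psi_ge0.
  move=> j; rewrite !survE.
  (* [psi_scale] covers positive arguments only. *)
  have [->|j0] := posnP j; first by rewrite mulr0 m0; exact: harris_pgf1 hN.
  have jR : 0 < j%:R :> R by rewrite ltr0n.
  have [Q0 QE] := harris_pgfE R _ _ P N a k _ hk ha hN (m01 _ (cx0 _ (ltW jR))).
  apply: (expVn_inj _ k) => //; first by have /andP[] := m01 _ (ltW jR).
  apply: (addIr (-1)); rewrite QE -!psiE ?cx0 ?ltW//.
  by rewrite [RHS]psi_scale// cE divp.
Qed.
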